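(* Let $(X,d)$ be a metric space, let $f,g:X\to X$ be self-mappings, and let $f$ be a Suzuki type $(Z_G,g)$-contraction. Assume that (i) $f(X)\subseteq g(X)$, and (ii) $g(X)$ or $f(X)$ is complete (as a metric subspace of $X$). Then $f$ and $g$ have a unique point of coincidence, i.e. there is exactly one $u\in X$ for which there exists $v\in X$ with $u=fv=gv$.
   Context: Metric spaces are assumed nonempty. A $C$-class function is a continuous map $G:[0,\infty)^2\to\mathbb{R}$ such that for all $s,t\in[0,\infty)$: $G(s,t)\le s$; and $G(s,t)=s$ implies $s=0$ or $t=0$. A map $G:[0,\infty)^2\to\mathbb{R}$ has property $C_G$ if there is a constant $C_G\ge 0$ such that (i) $G(s,t)>C_G$ implies $s>t$; (ii) $G(t,t)\le C_G$ for all $t\in[0,\infty)$. Fix a $C$-class function $G$ with property $C_G$, and fix the corresponding constant $C_G\ge 0$. A $C_G$-simulation function is a map $\zeta:[0,\infty)^2\to\mathbb{R}$ such that: (a) $\zeta(t,s)<G(s,t)$ for all $t,s>0$; (b) if $\{t_n\},\{s_n\}$ are sequences in $(0,\infty)$ with $\lim_{n\to\infty}t_n=\lim_{n\to\infty}s_n>0$ and $t_n<s_n$ for all $n$, then $\limsup_{n\to\infty}\zeta(t_n,s_n)<C_G$. $Z_G$ denotes the family of all $C_G$-simulation functions. For self-mappings $f,g$ of a metric space $(X,d)$, the mapping $f$ is a Suzuki type $(Z_G,g)$-contraction if there exists $\zeta\in Z_G$ such that for all $x,y\in X$ with $gx\ne gy$: $$\tfrac12 d(gx,fx)<d(gx,gy)\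 \Longrightarrow\ \zeta\big(d(fx,fy),d(gx,gy)\big)\ge C_G.$$ A point $u\in X$ is a point of coincidence of $f$ and $g$ if $u=fv=gv$ for some $v\in X$. *)

(* Defs.v *)
From HB Require Import structures.
From mathcomp Require Import all_boot all_order all_algebra.
From mathcomp Require Import all_classical all_reals all_analysis.

Set Implicit Arguments.
Unset Strict Implicit.
Unset Printing Implicit Defensive.

Import Order.TTheory GRing.Theory Num.Theory.
Import numFieldNormedType.Exports.

Local Open Scope classical_set_scope.
Local Open Scope ring_scope.

(* A map [0, +oo)^2 -> R is represented by a total function R -> R -> R of
   which only the values at nonnegative arguments are ever constrained. *)

Definition quadrant (R : realType) : set (R * R) :=
  [set p | 0 <= p.1 /\ 0 <= p.2].

Definition C_class (R : realType) (G : R -> R -> R) : Prop :=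
  [/\ {within @quadrant R, continuous (fun p : R * R => G p.1 p.2)},
      forall s t : R, 0 <= s -> 0 <= t -> G s t <= s &
      forall s t : R, 0 <= s -> 0 <= t -> G s t = s -> s = 0 \/ t = 0].

Definition has_property_CG (R : realType) (G : R -> R -> R) (CG : R) : Prop :=
  [/\ 0 <= CG,
      forall s t : R, 0 <= s -> 0 <= t -> CG < G s t -> t < s &
      forall t : R, 0 <= t -> G t t <= CG].

(* The upper limit is taken in the extended reals: zeta is not assumed to be
   bounded below, so that the upper limit may be -oo. *)
Definition Z_family (R : realType) (G : R -> R -> R) (CG : R) :
    set (R -> R -> R) :=
  [set zeta |
    (forall t s : R, 0 < t -> 0 < s -> zeta t s < G s t) /\
    (forall (t_ s_ : nat -> R) (l : R),
       (forall n, 0 < t_ n) -> (forall n, 0 < s_ n) ->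
       t_ n @[n --> \oo] --> l -> s_ n @[n --> \oo] --> l -> 0 < l ->
       (forall n, t_ n < s_ n) ->
       (limn_esup (fun n => (zeta (t_ n) (s_ n))%:E) < CG%:E)%E)].

Definition Suzuki_contraction (R : realType) (X : metricType R)
    (G : R -> R -> R) (CG : R) (f g : X -> X) : Prop :=
  exists2 zeta, Z_family G CG zeta &
    forall x y, g x <> g y ->
      2^-1 * mdist (g x) (f x) < mdist (g x) (g y) ->
      CG <= zeta (mdist (f x) (f y)) (mdist (g x) (g y)).

(* Completeness of A as a metric subspace. *)
Definition complete_subspace (R : realType) (X : metricType R) (A : set X) :
    Prop :=
  forall u : nat -> X, (forall n, A (u n)) -> cauchy (u n @[n --> \oo]) ->
    exists2 l, A l & u n @[n --> \oo] --> l.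

Definition point_of_coincidence (X : Type) (f g : X -> X) (u : X) : Prop :=
  exists v, u = f v /\ f v = g v.

(* Main.v *)
Require Import Defs.
From mathcomp Require Import all_boot all_order all_algebra.
From mathcomp Require Import all_classical all_reals all_analysis.
From mathcomp Require Import lra.

Set Implicit Arguments.
Unset Strict Implicit.
Unset Printing Implicit Defensive.

Import Order.TTheory GRing.Theory Num.Theory.
Import numFieldNormedType.Exports.

Local Open Scope classical_set_scope.
Local Open Scope ring_scope.

(** Evaluating axiom (a) of simulation functions and property (i) of C_G at a
    pair x, y that passes the Suzuki test d(gx, fx) / 2 < d(gx, gy) gives
    C_G <= zeta(d(fx, fy), d(gx, gy)) < G(d(gx, gy), d(fx, fy)), hence
    d(fx, fy) < d(gx, gy) (Suzuki_dist_lt). At two coincidence points v, w the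
    test is 0 < d(gv, gw), so different points of coincidence would satisfy
    d(gv, gw) < d(gv, gw): uniqueness.

    Axiom (b) upgrades this to sequences: if all pairs a_k, b_k pass the test
    and d(fa_k, fb_k), d(ga_k, gb_k) have the same limit l, then l <= 0, since
    otherwise the upper limit of a sequence bounded below by C_G would be less
    than C_G (Suzuki_cvg_le0). It is used twice for existence.

    Since f(X) is contained in g(X), there is a sequence with
    g x_(n+1) = f x_n; put y_n = f x_n. Assume that no coincidence point
    exists. Then y_n and y_(n+1) differ, the pair x_(n+1), x_(n+2) passes the
    test, and the steps d(y_n, y_(n+1)) strictly decrease to a limit, which is
    0 by the sequential principle (Jungck_steps_cvg0). A non-Cauchy sequence
    whose steps vanish has subsequences with d(y_(m k), y_(n k)) and
    d(y_(m k + 1), y_(n k + 1)) tending to the same e > 0 (not_cauchy_gap),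
    which the sequential principle forbids; so y is Cauchy (Jungck_cauchy).

    By completeness and f(X) <= g(X), y converges to some g v. The strict
    decrease of the steps implies that of two consecutive pairs x_(n+1), v and
    x_(n+2), v one passes the test, so that infinitely often
    d(y_(k+1), f v) < d(y_k, g v), and f v = g v in the limit
    (Jungck_limit_coincidence), a contradiction. *)

(** * Upper limits and metric sequences *)

Lemma limn_esup_ge (R : realType) (u : nat -> \bar R) (c : \bar R) :
  (forall n, c <= u n)%E -> (c <= limn_esup u)%E.
Proof.
move=> cu; rewrite limn_esup_lim; apply: lime_ge; first exact: is_cvg_esups.
apply: nearW => n; apply: (le_trans (cu n)).
by apply: ereal_sup_ubound; exists n => /=.
Qed.

(** The distance is 1-Lipschitz in each argument; hence moving both ends of a
    pair by vanishing amounts does not change the limit of the distance. *)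
Lemma metric_quadrilateral (R : realFieldType) (X : metricType R)
    (x y x' y' : X) :
  `|mdist x y - mdist x' y'| <= mdist x x' + mdist y y'.
Proof.
rewrite ler_distl lerBlDr.
have := metric_triangle x x' y; have := metric_triangle x' y' y.
have := metric_triangle x' x y'; have := metric_triangle x y y'.
rewrite (metric_sym y' y) (metric_sym x' x) => *; apply/andP; split; lra.
Qed.

Lemma not_cauchy_far (R : realType) (X : metricType R) (y : nat -> X) :
  ~ cauchy (y @ \oo) ->
  exists2 e : R, 0 < e &
    forall N, exists i j, [/\ (N <= i)%N, (i <= j)%N & e <= mdist (y i) (y j)].
Proof.
move=> ncy; apply/not_exists2P => far; apply: ncy.
apply/cauchy_ballP => e e0.
have [/(_ e0)//|/existsNP[N farN]] := far e.
rewrite near_map2 /=; near=> i j.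
have Ni : (N <= i)%N by near: i; exact: nbhs_infty_ge.
have Nj : (N <= j)%N by near: j; exact: nbhs_infty_ge.
rewrite ballEmdist /= ltNge; apply/negP => eij; apply: farN.
have [ij|/ltnW ji] := leqP i j; first by exists i, j.
by exists j, i; rewrite metric_sym.
Unshelve. all: by end_near. Qed.

(** Stopping at the first index where y leaves the ball of radius e around y i
    bounds the distance from above as well, by e plus one step. *)
Lemma first_exit (R : realType) (X : metricType R) (y : nat -> X) (e : R) i j :
  0 < e -> (i <= j)%N -> e <= mdist (y i) (y j) ->
  exists j', [/\ (i <= j')%N, e <= mdist (y i) (y j'.+1) &
                 mdist (y i) (y j') < e].
Proof.
move=> e0 ij eij.
have exk : exists k, (i <= k)%N && (e <= mdist (y i) (y k)).
  by exists j; rewrite ij.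
have [[|k] /andP[ik ek] kmin] := ex_minnP exk.
  by move: ik ek; rewrite leqn0 => /eqP ->; rewrite mdistxx leNgt e0.
move: ik; rewrite leq_eqVlt ltnS => /predU1P[ik|ik].
  by move: ek; rewrite -ik mdistxx leNgt e0.
exists k; split => //; rewrite ltNge; apply/negP => ek'.
by have := kmin k; rewrite ik ek' ltnn => /(_ isT).
Qed.

(** The classical way to use a contraction condition at a positive limit: at
    first exits the distance lies between e and e plus one step, and passing to
    the successors changes it by at most two steps. *)
Lemma not_cauchy_gap (R : realType) (X : metricType R) (y : nat -> X) :
  mdist (y n) (y n.+1) @[n --> \oo] --> (0 : R) -> ~ cauchy (y @ \oo) ->
  exists (e : R) (m n : nat -> nat),
    [/\ 0 < e, (forall k, k <= m k)%N, (forall k, k <= n k)%N,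
        mdist (y (m k)) (y (n k)) @[k --> \oo] --> e &
        mdist (y (m k).+1) (y (n k).+1) @[k --> \oo] --> e].
Proof.
move=> dy0 /not_cauchy_far[e e0 far].
have /choice[p pP] : forall k, exists p : nat * nat,
    [/\ (k <= p.1)%N, (k <= p.2)%N, e <= mdist (y p.1) (y p.2.+1) &
        mdist (y p.1) (y p.2) < e].
  move=> k; have [i [j [ki ij eij]]] := far k.
  have [j' [ij' ej' j'e]] := first_exit e0 ij eij.
  by exists (i, j'); split => //=; exact: leq_trans ij'.
pose m k := (p k).1; pose n k := (p k).2.+1.
have mk k : (k <= m k)%N by have [] := pP k.
have nk k : (k <= n k)%N by have [_ kp _ _] := pP k; rewrite (leq_trans kp).
(* The indices tend to infinity with k, so the steps there still vanish. *)
have dsub (q : nat -> nat) : (forall k, k <= q k)%N ->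
    mdist (y (q k)) (y (q k).+1) @[k --> \oo] --> (0 : R).
  move=> qk; apply: (@cvg_comp _ _ _ q _ \oo) dy0 => P [N _ NP].
  by exists N => // k /= Nk; apply: NP => /=; rewrite (leq_trans Nk).
have cvmn : mdist (y (m k)) (y (n k)) @[k --> \oo] --> e.
  apply: (@squeeze_cvgr _ _ _ _ (cst e)
    (fun k => e + mdist (y (p k).2) (y (p k).2.+1))); last 2 first.
  - exact: cvg_cst.
  - rewrite -[X in _ --> X]addr0; apply: cvgD; first exact: cvg_cst.
    by apply: (dsub (fun k => (p k).2)) => k; have [] := pP k.
  apply: nearW => k; have [_ _ em me] := pP k; rewrite em /=.
  by apply: le_trans (metric_triangle _ (y (p k).2) _) _; rewrite lerD2r ltW.
exists e, m, n; split => //.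
have cvb : mdist (y (m k)) (y (m k).+1) + mdist (y (n k)) (y (n k).+1)
    @[k --> \oo] --> (0 : R).
  by rewrite -[0]addr0; apply: cvgD; exact: dsub.
apply: (@squeeze_cvgr _ _ _ _
  (fun k => mdist (y (m k)) (y (n k)) -
     (mdist (y (m k)) (y (m k).+1) + mdist (y (n k)) (y (n k).+1)))
  (fun k => mdist (y (m k)) (y (n k)) +
     (mdist (y (m k)) (y (m k).+1) + mdist (y (n k)) (y (n k).+1)))).
- by apply: nearW => k; rewrite -ler_distl distrC; exact: metric_quadrilateral.
- by rewrite -[X in _ --> X]subr0; exact: cvgB.
- by rewrite -[X in _ --> X]addr0; exact: cvgD.
Qed.

(** * Consequences of the Suzuki contraction condition *)

(** The Suzuki test already forces g x and g y to differ. If f x = f y there is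
    nothing to do; otherwise both distances are positive, as axiom (a)
    demands. *)
Lemma Suzuki_dist_lt (R : realType) (X : metricType R) (G : R -> R -> R)
    (CG : R) (f g : X -> X) (x y : X) :
  has_property_CG G CG -> Suzuki_contraction G CG f g ->
  2^-1 * mdist (g x) (f x) < mdist (g x) (g y) ->
  mdist (f x) (f y) < mdist (g x) (g y).
Proof.
move=> [_ CGlt _] [zeta [zetaG _] zetaf] hxy.
have gxy0 : 0 < mdist (g x) (g y).
  by apply: le_lt_trans hxy; rewrite mulr_ge0 ?mdist_ge0.
have gxy : g x <> g y by apply/eqP; rewrite -mdist_gt0.
have [->//|fxy] := eqVneq (mdist (f x) (f y)) 0.
have fxy0 : 0 < mdist (f x) (f y) by rewrite lt_neqAle eq_sym fxy mdist_ge0.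
apply: CGlt; rewrite ?mdist_ge0//.
exact: le_lt_trans (zetaf _ _ gxy hxy) (zetaG _ _ fxy0 gxy0).
Qed.

(** The form in which axiom (b) is applied: a common positive limit of the two
    distances would squeeze the upper limit of zeta strictly below C_G, while
    the contraction condition keeps zeta at least C_G. *)
Lemma Suzuki_cvg_le0 (R : realType) (X : metricType R) (G : R -> R -> R)
    (CG : R) (f g : X -> X) (a b : nat -> X) (l : R) :
  has_property_CG G CG -> Suzuki_contraction G CG f g ->
  (\forall k \near \oo,
     2^-1 * mdist (g (a k)) (f (a k)) < mdist (g (a k)) (g (b k))) ->
  mdist (f (a k)) (f (b k)) @[k --> \oo] --> l ->
  mdist (g (a k)) (g (b k)) @[k --> \oo] --> l ->
  l <= 0.
Proof.
move=> hCG hf hab fl gl; rewrite leNgt; apply/negP => l0.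
(* Axiom (b) asks for positivity at every index; drop the first N terms. *)
have [N _ hN] : \forall k \near \oo,
    [/\ 0 < mdist (f (a k)) (f (b k)), 0 < mdist (g (a k)) (g (b k)) &
     2^-1 * mdist (g (a k)) (f (a k)) < mdist (g (a k)) (g (b k))].
  near=> k; split; near: k => //.
  - exact: cvgr_gt fl _ l0.
  - exact: cvgr_gt gl _ l0.
have hS k : [/\ 0 < mdist (f (a (k + N)%N)) (f (b (k + N)%N)),
     0 < mdist (g (a (k + N)%N)) (g (b (k + N)%N)) &
     2^-1 * mdist (g (a (k + N)%N)) (f (a (k + N)%N)) <
       mdist (g (a (k + N)%N)) (g (b (k + N)%N))].
  by apply: hN; rewrite /= leq_addl.
have [zeta [_ zetalim] zetaf] := hf.
pose t k := mdist (f (a (k + N)%N)) (f (b (k + N)%N)).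
pose s k := mdist (g (a (k + N)%N)) (g (b (k + N)%N)).
suff : (limn_esup (fun k => (zeta (t k) (s k))%:E) < CG%:E)%E.
  rewrite ltNge limn_esup_ge// => k; have [_ s0 h] := hS k.
  by rewrite lee_fin; apply: zetaf h; apply/eqP; rewrite -mdist_gt0.
apply: (zetalim _ _ l) => //.
- by move=> k; have [] := hS k.
- by move=> k; have [] := hS k.
- by rewrite (cvg_shiftn N (fun k => mdist (f (a k)) (f (b k)))).
- by rewrite (cvg_shiftn N (fun k => mdist (g (a k)) (g (b k)))).
- by move=> k; have [_ _] := hS k; exact: Suzuki_dist_lt hCG hf.
Unshelve. all: by end_near. Qed.

(** * The Jungck sequence *)

Lemma Jungck_sequence (T : Type) (f g : T -> T) (x0 : T) :
  range f `<=` range g -> exists x : nat -> T, forall n, g (x n.+1) = f (x n).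
Proof.
move=> fg; have /choice[h hP] : forall x, exists y, g y = f x.
  by move=> x; have [|y _ gy] := fg (f x); [exists x|exists y].
by exists (fun n => iter n h x0) => n /=.
Qed.

(** The test at x_(n+1), x_(n+2) compares half of a positive number with the
    number itself. *)
Lemma Jungck_test (R : realType) (X : metricType R) (f g : X -> X)
    (x : nat -> X) :
  (forall n, g (x n.+1) = f (x n)) -> (forall n, f (x n) <> f (x n.+1)) ->
  forall n, 2^-1 * mdist (g (x n.+1)) (f (x n.+1)) <
            mdist (g (x n.+1)) (g (x n.+2)).
Proof.
move=> gx fx n; rewrite !gx gtr_pMl ?invf_lt1 ?ltr1n//.
by rewrite mdist_gt0; apply/eqP.
Qed.

Lemma Jungck_steps_decrease (R : realType) (X : metricType R) (G : R -> R -> R)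
    (CG : R) (f g : X -> X) (x : nat -> X) :
  has_property_CG G CG -> Suzuki_contraction G CG f g ->
  (forall n, g (x n.+1) = f (x n)) -> (forall n, f (x n) <> f (x n.+1)) ->
  forall n, mdist (f (x n.+1)) (f (x n.+2)) < mdist (f (x n)) (f (x n.+1)).
Proof.
move=> hCG hf gx fx n.
by have := Suzuki_dist_lt hCG hf (Jungck_test gx fx n); rewrite !gx.
Qed.

Lemma Jungck_steps_cvg0 (R : realType) (X : metricType R) (G : R -> R -> R)
    (CG : R) (f g : X -> X) (x : nat -> X) :
  has_property_CG G CG -> Suzuki_contraction G CG f g ->
  (forall n, g (x n.+1) = f (x n)) -> (forall n, f (x n) <> f (x n.+1)) ->
  mdist (f (x n)) (f (x n.+1)) @[n --> \oo] --> (0 : R).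
Proof.
move=> hCG hf gx fx.
pose d n := mdist (f (x n)) (f (x n.+1)).
have /cvg_ex[/= l dl] : cvgn d.
  apply: nonincreasing_is_cvgn.
    apply/nonincreasing_seqP => n; apply: ltW.
    exact: Jungck_steps_decrease hCG hf gx fx n.
  by exists 0 => _ [n _ <-]; exact: mdist_ge0.
suff l0 : l = 0 by rewrite -l0.
apply/eqP; rewrite eq_le; apply/andP; split; last first.
  by apply: (cvgr_to_ge dl); apply: nearW => n; exact: mdist_ge0.
apply: (@Suzuki_cvg_le0 _ _ _ _ _ _ (fun n => x n.+1) (fun n => x n.+2) _
  hCG hf).
- by apply: nearW => n; exact: Jungck_test gx fx n.
- by rewrite (cvg_shiftS d).
- by rewrite (eq_cvg _ _ (fun n => _ : _ = d n)) => // n; rewrite !gx.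
Qed.

Lemma Jungck_cauchy (R : realType) (X : metricType R) (G : R -> R -> R)
    (CG : R) (f g : X -> X) (x : nat -> X) :
  has_property_CG G CG -> Suzuki_contraction G CG f g ->
  (forall n, g (x n.+1) = f (x n)) ->
  mdist (f (x n)) (f (x n.+1)) @[n --> \oo] --> (0 : R) ->
  cauchy (f (x n) @[n --> \oo]).
Proof.
move=> hCG hf gx dx0; apply: contrapT.
move=> /(not_cauchy_gap dx0)[e [m [n [e0 mk nk fmn fmn1]]]].
suff : e <= 0 by rewrite leNgt e0.
apply: (@Suzuki_cvg_le0 _ _ _ _ _ _ (fun k => x (m k).+1)
  (fun k => x (n k).+1) _ hCG hf) => //.
(* Eventually the steps are below e / 2 and the gaps above it. *)
- have e20 : 0 < e / 2 by rewrite divr_gt0.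
  have [N _ dN] := cvgr_lt _ dx0 _ e20.
  near=> k; rewrite !gx.
  have big : e / 2 < mdist (f (x (m k))) (f (x (n k))).
    by near: k; apply: (cvgr_gt _ fmn); rewrite ltr_pdivrMr// ltr_pMr// ltr1n.
  have small : mdist (f (x (m k))) (f (x (m k).+1)) < e / 2.
    by apply: dN; apply: leq_trans (mk k); near: k; exact: nbhs_infty_ge.
  have := mdist_ge0 (f (x (m k))) (f (x (m k).+1)); lra.
- by under eq_fun do rewrite !gx.
Unshelve. all: by end_near. Qed.

(** Suzuki's alternative: if both tests failed for consecutive terms y_n,
    y_(n+1) against the limit, then the triangle inequality would bound the
    step at n by the mean of the steps at n and n + 1, which is smaller. *)
Lemma Jungck_limit_coincidence (R : realType) (X : metricType R)
    (G : R -> R -> R) (CG : R) (f g : X -> X) (x : nat -> X) (v : X) :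
  has_property_CG G CG -> Suzuki_contraction G CG f g ->
  (forall n, g (x n.+1) = f (x n)) ->
  (forall n, mdist (f (x n.+1)) (f (x n.+2)) < mdist (f (x n)) (f (x n.+1))) ->
  f (x n) @[n --> \oo] --> g v -> f v = g v.
Proof.
move=> hCG hf gx dec xv.
have close n :
  mdist (g v) (f v) <= mdist (g v) (f (x n)) + mdist (g v) (f (x n.+1)) \/
  mdist (g v) (f v) <= mdist (g v) (f (x n.+1)) + mdist (g v) (f (x n.+2)).
  have step k : 2^-1 * mdist (f (x k)) (f (x k.+1)) < mdist (f (x k)) (g v) ->
      mdist (g v) (f v) <= mdist (g v) (f (x k)) + mdist (g v) (f (x k.+1)).
    have := @Suzuki_dist_lt _ _ _ _ _ _ (x k.+1) v hCG hf.
    rewrite !gx => /[apply] fxv.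
    apply: le_trans (metric_triangle _ (f (x k.+1)) _) _.
    by rewrite addrC lerD2r (metric_sym (g v)) ltW.
  have [/step|h1] := ltP (2^-1 * mdist (f (x n)) (f (x n.+1)))
    (mdist (f (x n)) (g v)); first by left.
  right; apply: step; rewrite ltNge; apply/negP => h2.
  have := metric_triangle (f (x n)) (g v) (f (x n.+1)); have := dec n.
  rewrite (metric_sym (g v)); lra.
apply/esym/mdist_positivity/eqP; rewrite eq_le mdist_ge0 andbT.
apply/ler_addgt0Pl => e e0; rewrite addr0.
have e20 : 0 < e / 2 by rewrite divr_gt0.
have [N _ dN] := metricType_numDomainType.cvgr_dist_lt xv e20.
have := dN N (leqnn _); have := dN N.+1 (leqnSn _).
have := dN N.+2 (leqW (leqnSn _)); rewrite /=.
by have [] := close N; lra.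
Qed.

(** * Points of coincidence *)

Theorem theorem3p3 (R : realType) (X : metricType R) (hX : [set: X] !=set0)
    (G : R -> R -> R) (CG : R)
    (hG : C_class G) (hCG : has_property_CG G CG)
    (f g : X -> X) (hf : Suzuki_contraction G CG f g)
    (hfg : range f `<=` range g)
    (hcomplete : complete_subspace (range g) \/ complete_subspace (range f)) :
  exists! u : X, point_of_coincidence f g u.
Proof.
suff [v fv] : exists v, f v = g v.
  exists (f v); split; first by exists v.
  move=> _ [w [-> fw]]; apply: contrapT => fvw.
  have : 2^-1 * mdist (g v) (f v) < mdist (g v) (g w).
    by rewrite -fv -fw mdistxx mulr0 mdist_gt0; apply/eqP.
  by move=> /(Suzuki_dist_lt hCG hf); rewrite -fv -fw ltxx.
apply: contrapT => /forallNP nofg.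
have [x0 _] := hX; have [x gx] := Jungck_sequence x0 hfg.
have fx n : f (x n) <> f (x n.+1).
  by rewrite -gx => /esym; exact: nofg.
have dec := Jungck_steps_decrease hCG hf gx fx.
have dx0 := Jungck_steps_cvg0 hCG hf gx fx.
have cx := Jungck_cauchy hCG hf gx dx0.
have [_ [v _ <-] xv] : exists2 l, range g l & f (x n) @[n --> \oo] --> l.
  case: hcomplete => [|cplf]; first by apply => // n; apply: hfg; exists (x n).
  have [|l fl xl] := cplf _ _ cx; first by move=> n; exists (x n).
  by exists l => //; exact: hfg.
exact: nofg (Jungck_limit_coincidence hCG hf gx dec xv).
Qed.
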